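(* Let $d: E \rightarrow \mathbb{R}$ be given. Let $f^*$ be an optimal flow in Flow($d$) and let $x^*$ be an optimal solution of DualFlow($d$). Define the function $d^*: E \rightarrow \mathbb{R}$ by $d^*_{uv}=f^*_{uv}-f^*_{vu}$ for each $(u,v)\in E$. Then $b^d_v=b^{d^*}_v$ for all $v\in V$, i.e. the problems Flow($d$) and Flow($d^*$) coincide, and so do DualFlow($d$) and DualFlow($d^*$). Moreover, the common optimal value of these problems is equal to $\|d^*\|_1$, i.e. $$\sum_{(u,v)\in \bar{E}} f^*_{uv}=\sum_{v\in V} b^{d^*}_v x^*_v=\|d^*\|_1 .$$
   Context: Let $s, N\in\mathbb{N}$ and let $\epsilon_\ell$, $\ell=1,\dots,s$, be the standard unit vectors of $\mathbb{R}^s$. $G=(V,E)$ is the directed graph with vertex set $V=\{-N-2,\ldots,0\}^s$ and edge set $E=\{(\beta,\beta-\epsilon_\ell): \beta\in\{-N-1,\ldots,0\}^s,\ \ell=1,\ldots,s\}$. The associated symmetric directed graph is $\bar{G}=(V,\bar{E})$ with $\bar{E}=E\cup\{(v,u): (u,v)\in E\}$. For a function $d:E\to\mathbb{R}$ write $d_{uv}=d((u,v))$, $\|d\|_1=\sum_{(u,v)\in E}|d_{uv}|$, and $$b^d_v=\sum_{u:(v,u)\in E} d_{vu}-\sum_{u:(u,v)\in E} d_{uv},\quad v\in V.$$ Flow($d$) is the linear optimization problem: minimize $\sum_{(u,v)\in\bar{E}} f_{uv}$ over functions $f:\bar{E}\to\mathbb{R}$ subject to $\sum_{u:(v,u)\in\bar{E}}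 f_{vu}-\sum_{u:(u,v)\in\bar{E}} f_{uv}=b^d_v$ for all $v\in V$ and $f_{uv}\ge 0$ for all $(u,v)\in\bar{E}$. An optimal flow is an optimal solution of Flow($d$). DualFlow($d$) is the linear optimization problem: maximize $\sum_{v\in V} b^d_v x_v$ over functions $x:V\to\mathbb{R}$ subject to $x_v-x_u\le 1$ for all $(u,v)\in\bar{E}$. *)

(* Defs.v *)
From HB Require Import structures.
From mathcomp Require Import all_boot all_order all_algebra.
From mathcomp Require Import reals.

Set Implicit Arguments.
Unset Strict Implicit.
Unset Printing Implicit Defensive.

Import Order.TTheory GRing.Theory Num.Theory.
Local Open Scope ring_scope.

Inductive lp_sense := Minimize | Maximize.

Record lp (R : realType) (X : Type) := LP {
  sense : lp_sense;
  objective : X -> R;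
  feasible : X -> Prop }.

Definition optimal (R : realType) (X : Type) (P : lp R X) (x : X) : Prop :=
  feasible P x /\
  forall y, feasible P y ->
    match sense P with
    | Minimize => objective P x <= objective P y
    | Maximize => objective P y <= objective P x
    end.

(* The vertex set {-N-2, ..., 0}^s; each coordinate is stored as its opposite,
   a natural number at most N+2, and [coord] returns the actual point of Z^s. *)
Definition vertex (s N : nat) := {ffun 'I_s -> 'I_N.+3}.

Definition coord (s N : nat) (v : vertex s N) : 'rV[int]_s :=
  \row_i - (v i)%:Z.

(* [delta_mx 0 l] is the standard unit vector with index l. *)
Definition E (s N : nat) : {set vertex s N * vertex s N} :=
  [set e | [forall i, - (N.+1)%:Z <= coord e.1 0 i <= 0]
           && [exists l, coord e.2 == coord e.1 - delta_mx 0 l]].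

Definition rev_pair (T : Type) (e : T * T) : T * T := (e.2, e.1).

Definition Ebar (s N : nat) : {set vertex s N * vertex s N} :=
  E s N :|: [set rev_pair e | e in E s N].

Notation edge s N := {e : vertex s N * vertex s N | e \in E s N}.
Notation dedge s N := {e : vertex s N * vertex s N | e \in Ebar s N}.

Lemma fwd_subproof (s N : nat) (e : edge s N) : val e \in Ebar s N.
Proof. by rewrite inE (valP e). Qed.

Lemma bwd_subproof (s N : nat) (e : edge s N) : rev_pair (val e) \in Ebar s N.
Proof. by rewrite inE imset_f ?orbT // (valP e). Qed.

(* For e = (u, v) in E, [fwd e] and [bwd e] are (u, v) and (v, u) in Ebar. *)
Definition fwd (s N : nat) (e : edge s N) : dedge s N :=
  Sub (val e) (fwd_subproof e).

Definition bwd (s N : nat) (e : edge s N) : dedge s N :=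
  Sub (rev_pair (val e)) (bwd_subproof e).

Definition norm1 (R : realType) (s N : nat) (d : {ffun edge s N -> R}) : R :=
  \sum_(e : edge s N) `|d e|.

(* Outflow minus inflow of d at v. *)
Definition bflow (R : realType) (s N : nat) (d : {ffun edge s N -> R}) :
    {ffun vertex s N -> R} :=
  [ffun v => \sum_(e : edge s N | (val e).1 == v) d e
             - \sum_(e : edge s N | (val e).2 == v) d e].

Definition Flow (R : realType) (s N : nat) (d : {ffun edge s N -> R}) :
    lp R {ffun dedge s N -> R} :=
  {| sense := Minimize;
     objective := fun f : {ffun dedge s N -> R} => \sum_(e : dedge s N) f e;
     feasible := fun f : {ffun dedge s N -> R} =>
       (forall v : vertex s N,
          \sum_(e : dedge s N | (val e).1 == v) f e
          - \sum_(e : dedge s N | (val e).2 == v) f e = bflow d v)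
       /\ (forall e : dedge s N, 0 <= f e) |}.

Definition DualFlow (R : realType) (s N : nat) (d : {ffun edge s N -> R}) :
    lp R {ffun vertex s N -> R} :=
  {| sense := Maximize;
     objective := fun x : {ffun vertex s N -> R} =>
       \sum_(v : vertex s N) bflow d v * x v;
     feasible := fun x : {ffun vertex s N -> R} =>
       forall u v : vertex s N, (u, v) \in Ebar s N -> x v - x u <= 1 |}.

Definition dstar (R : realType) (s N : nat) (f : {ffun dedge s N -> R}) :
    {ffun edge s N -> R} :=
  [ffun e => f (fwd e) - f (bwd e)].

(* Main.v *)
(** Let [f] and [x] be optimal for a min-cost flow problem and its dual, and let
    [w e - (x (src e) - x (tgt e)) >= 0] be the reduced cost of the arc [e]. Suppose
    that some arc from [a] to [b] carries flow and has positive reduced cost. Let [S]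
    be the set of vertices reachable from [a] along arcs of reduced cost zero and
    along reversed arcs carrying flow. If [b] is in [S], then closing a walk from [a]
    to [b] with the reversed arc gives a circulation of negative cost along which
    [f] can be improved. If [b] is not in [S], then no flow enters [S] and some flow
    leaves it, and [x] can be improved by raising it on [S]. Hence complementary
    slackness holds, which gives equality of the optimal values. Since both
    [x u - x v] and [x v - x u] cannot be [1], opposite arcs do not both carry
    flow, so [`|f_uv - f_vu| = f_uv + f_vu]. *)
Require Import Defs.
From mathcomp Require Import all_boot all_order all_algebra.
From mathcomp Require Import reals.
From mathcomp Require Import ring lra.
Import Order.TTheory GRing.Theory Num.Theory.
Local Open Scope ring_scope.

Lemma exists_pos_lower_bound (R : realFieldType) (I : finType) (P : pred I)
    (r : I -> R) :
  (forall i, P i -> 0 < r i) ->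
  exists2 eps, 0 < eps & forall i, P i -> eps <= r i.
Proof.
(* The default [1] keeps the minimum positive when no index satisfies [P]. *)
move=> r_gt0; exists (\big[Num.min/1]_(i | P i) r i).
  by apply: (big_ind (fun x => 0 < x)) => // x y x0 y0; rewrite lt_min x0.
by move=> i Pi; rewrite (bigD1 i) //= ge_min lexx.
Qed.

(** * Min-cost flow with uncapacitated arcs, and its dual *)

Section MinCostFlow.
Variables (R : realFieldType) (V A : finType) (src tgt : A -> V) (w : A -> R).
Implicit Types (f g : A -> R) (x : V -> R).

Definition divergence f (v : V) : R :=
  \sum_(e | src e == v) f e - \sum_(e | tgt e == v) f e.

Definition reduced_cost x (e : A) : R := w e - (x (src e) - x (tgt e)).

(** Summation by parts: grouping the arcs by source and by target moves the potential from vertices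
    to arcs. *)
Lemma sum_divergence f x :
  \sum_v divergence f v * x v = \sum_e f e * (x (src e) - x (tgt e)).
Proof.
have sum_at (h : A -> V) :
    \sum_v (\sum_(e | h e == v) f e) * x v = \sum_e f e * x (h e).
  rewrite [RHS](partition_big h xpredT) //=; apply: eq_bigr => v _.
  by rewrite mulr_suml; apply: eq_bigr => e /eqP ->.
under eq_bigr do rewrite mulrBl.
by rewrite sumrB !sum_at -sumrB; apply: eq_bigr => e _; rewrite mulrBr.
Qed.

Lemma divergenceD f g v :
  divergence (fun e => f e + g e) v = divergence f v + divergence g v.
Proof. by rewrite /divergence !big_split /=; ring. Qed.

Lemma divergenceZ k f v :
  divergence (fun e => k * f e) v = k * divergence f v.
Proof. by rewrite /divergence -!mulr_sumr -mulrBr. Qed.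

Lemma divergence_delta a v :
  divergence (fun e => (e == a)%:R) v = (src a == v)%:R - (tgt a == v)%:R.
Proof.
have sum_delta (P : pred A) : \sum_(e | P e) (e == a)%:R = (P a)%:R :> R.
  rewrite big_mkcond (bigD1 a) //= big1 ?eqxx ?addr0; first by case: (P a).
  by move=> e /negPf ->; case: (P e).
by rewrite /divergence !sum_delta.
Qed.

(** Passing to reduced costs changes the total cost only through the divergence, so it does not
    change the cost of a circulation. *)
Lemma sum_cost_divergence f x :
  \sum_e w e * f e =
  \sum_e reduced_cost x e * f e + \sum_v divergence f v * x v.
Proof.
rewrite sum_divergence -big_split /=; apply: eq_bigr => e _.
by rewrite /reduced_cost; ring.
Qed.

(** Unlike in the usual residual graph, a forward arc must be tight. Thus a forward step has reduced
    cost zero, and a backward step costs minus a reduced cost, hence at most zero. *)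
Definition residual f x : rel V := fun u v =>
  [exists e, [&& src e == u, tgt e == v & reduced_cost x e == 0]]
  || [exists e, [&& src e == v, tgt e == u & 0 < f e]].

Section ComplementarySlackness.
Variables (f : A -> R) (x : V -> R).
Hypothesis f_ge0 : forall e, 0 <= f e.
Hypothesis x_feasible : forall e, x (src e) - x (tgt e) <= w e.

Let reduced_cost_ge0 e : 0 <= reduced_cost x e.
Proof. by rewrite /reduced_cost subr_ge0. Qed.

Let sum_reduced_cost_delta g k a :
  \sum_e reduced_cost x e * (g e + k * (e == a)%:R) =
  \sum_e reduced_cost x e * g e + k * reduced_cost x a.
Proof.
under eq_bigr do rewrite mulrDr.
rewrite big_split /=; congr (_ + _).
rewrite (bigD1 a) //= big1 ?eqxx; first by rewrite addr0 mulr1 mulrC.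
by move=> e /negPf ->; rewrite !mulr0.
Qed.

(** Send one unit along the walk: each forward step adds [1] on its arc, each backward step
    subtracts [1]. Subtraction happens only where [f] is positive, and no step raises the reduced
    cost. *)
Lemma residual_walk_flow a b : connect (residual f x) a b ->
  exists g : A -> R,
    [/\ forall v, divergence g v = (a == v)%:R - (b == v)%:R,
        forall e, f e = 0 -> 0 <= g e
      & \sum_e reduced_cost x e * g e <= 0].
Proof.
case/connectP => p; elim/last_ind: p b => [|p c IH] b /=.
  move=> _ ->; exists (fun=> 0); split=> // [v|].
    by rewrite /divergence !big1 // !subrr.
  by rewrite big1 // => e _; rewrite mulr0.
rewrite rcons_path last_rcons => /andP[a_p pc] ->.
have [g [div_g g_ge0 cost_g]] := IH _ a_p erefl.
case/orP: pc => /existsP[e /and3P[/eqP src_e /eqP tgt_e e_res]].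
  exists (fun e' => g e' + 1 * (e' == e)%:R); split=> [v|e' fe'|].
  - rewrite divergenceD divergenceZ divergence_delta div_g src_e tgt_e; ring.
  - by rewrite mul1r addr_ge0 ?g_ge0.
  - by rewrite sum_reduced_cost_delta (eqP e_res) mulr0 addr0.
exists (fun e' => g e' + (-1) * (e' == e)%:R); split=> [v|e' fe'|].
- rewrite divergenceD divergenceZ divergence_delta div_g src_e tgt_e; ring.
- have /negPf-> : e' != e by apply: contraTneq e_res => <-; rewrite fe' ltxx.
  by rewrite mulr0 addr0 g_ge0.
- by rewrite sum_reduced_cost_delta; have := reduced_cost_ge0 e; lra.
Qed.

Hypothesis f_optimal : forall g, (forall e, 0 <= g e) ->
  (forall v, divergence g v = divergence f v) ->
  \sum_e w e * f e <= \sum_e w e * g e.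

(** For small [eps > 0] the flow [f + eps * g] is still feasible, so optimality of [f] bounds the
    cost of [g] from below. *)
Lemma circulation_cost_ge0 g :
  (forall v, divergence g v = 0) -> (forall e, f e = 0 -> 0 <= g e) ->
  0 <= \sum_e w e * g e.
Proof.
move=> div_g g_ge0.
(* This bound gives [eps * |g e| <= f e] wherever [f] is positive; the added [1] keeps the divisor
   positive. *)
have [eps eps_gt0 eps_le] :
    exists2 eps, 0 < eps & forall e, 0 < f e -> eps <= f e / (`|g e| + 1).
  apply: exists_pos_lower_bound => e fe_gt0.
  by rewrite divr_gt0 // ltr_wpDl.
have: \sum_e w e * f e <= \sum_e w e * (f e + eps * g e).
  apply: f_optimal => [e|v]; last first.
    by rewrite divergenceD divergenceZ div_g mulr0 addr0.
  have := f_ge0 e; rewrite le_eqVlt => /predU1P[fe0|fe_gt0].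
    by rewrite -fe0 add0r mulr_ge0 ?g_ge0 ?(ltW eps_gt0).
  have := eps_le e fe_gt0; rewrite ler_pdivlMr ?ltr_wpDl // mulrDr mulr1.
  have : - `|eps * g e| <= eps * g e by rewrite lerNl -normrN ler_norm.
  by rewrite normrM (gtr0_norm eps_gt0); lra.
under [leRHS]eq_bigr do rewrite mulrDr mulrCA.
by rewrite big_split /= -mulr_sumr lerDl pmulr_rge0.
Qed.

Hypothesis x_optimal : forall y, (forall e, y (src e) - y (tgt e) <= w e) ->
  \sum_v divergence f v * y v <= \sum_v divergence f v * x v.

(** Raising [x] by a small [eps] on [S] tightens only the constraints of arcs leaving [S], which
    have slack. The dual objective then grows by [eps] times the net flow out of [S]. *)
Lemma cut_flow_le0 (S : pred V) :
  (forall e, S (src e) -> ~~ S (tgt e) -> 0 < reduced_cost x e) ->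
  \sum_e f e * ((S (src e))%:R - (S (tgt e))%:R) <= 0.
Proof.
move=> cut_gt0.
have [eps eps_gt0 eps_le] : exists2 eps, 0 < eps &
    forall e, S (src e) && ~~ S (tgt e) -> eps <= reduced_cost x e.
  by apply: exists_pos_lower_bound => e /andP[]; apply: cut_gt0.
have: \sum_v divergence f v * (x v + eps * (S v)%:R)
      <= \sum_v divergence f v * x v.
  apply: x_optimal => e; have := eps_le e; have := x_feasible e.
  rewrite /reduced_cost; case: (S (src e)); case: (S (tgt e)) => /= h le_eps;
    try (have := le_eps isT); lra.
under eq_bigr do rewrite mulrDr mulrCA.
by rewrite big_split /= -mulr_sumr gerDl pmulr_rle0 // sum_divergence.
Qed.

Theorem complementary_slackness e : 0 < f e -> x (src e) - x (tgt e) = w e.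
Proof.
move=> fe_gt0; apply/eqP; rewrite eq_sym -subr_eq0; apply: contraT => ce_neq0.
have ce_gt0 : 0 < reduced_cost x e by rewrite lt0r ce_neq0 reduced_cost_ge0.
have [/residual_walk_flow[g [div_g g_ge0 cost_g]]|not_conn] :=
    boolP (connect (residual f x) (src e) (tgt e)).
  (* Cancelling one unit on [e] closes the walk into a circulation, whose cost is at most
     [- reduced_cost x e < 0]. *)
  pose h e' := g e' + (-1) * (e' == e)%:R.
  have div_h v : divergence h v = 0.
    by rewrite divergenceD divergenceZ divergence_delta div_g; ring.
  suff /(circulation_cost_ge0 _ div_h) :
      forall e', f e' = 0 -> 0 <= h e'.
    rewrite (sum_cost_divergence _ x) sum_reduced_cost_delta.
    rewrite [X in _ + X]big1 => [|v _]; first by lra.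
    by rewrite div_h mul0r.
  move=> e' fe'; rewrite /h; have /negPf-> : e' != e.
    by apply: contraTneq fe_gt0 => <-; rewrite fe' ltxx.
  by rewrite mulr0 addr0 g_ge0.
pose S := connect (residual f x) (src e).
have S_closed u v : S u -> residual f x u v -> S v.
  by move=> Su uv; apply: connect_trans Su (connect1 uv).
have /cut_flow_le0 : forall e', S (src e') -> ~~ S (tgt e') ->
    0 < reduced_cost x e'.
  move=> e' Ssrc; apply: contraR; rewrite lt0r reduced_cost_ge0 andbT negbK.
  move=> c0; apply: S_closed Ssrc _; apply/orP; left.
  by apply/existsP; exists e'; rewrite !eqxx.
have Stgt : S (tgt e) = false by apply: negPf.
(* The arc [e] leaves [S] and contributes [f e > 0], so it remains to see that the other arcs
   contribute no negative term. *)
rewrite (bigD1 e) //= {1}/S connect0 Stgt subr0 mulr1.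
move=> sum_le0; suff: 0 <= \sum_(i | i != e)
    f i * ((S (src i))%:R - (S (tgt i))%:R) by move: sum_le0 fe_gt0; lra.
apply: sumr_ge0 => e' _; have := f_ge0 e'; rewrite le_eqVlt.
case/predU1P => [<-|fe'_gt0]; first by rewrite mul0r.
rewrite mulr_ge0 // subr_ge0 ler_nat; case St: (S (tgt e')) => //.
suff -> : S (src e') by [].
apply: S_closed St _; apply/orP; right.
by apply/existsP; exists e'; rewrite !eqxx.
Qed.

(** The sums agree arc by arc: an arc without flow contributes zero to both, and an arc with flow is
    tight. *)
Corollary strong_duality :
  \sum_e w e * f e = \sum_v divergence f v * x v.
Proof.
rewrite sum_divergence; apply: eq_bigr => e _.
have := f_ge0 e; rewrite le_eqVlt => /predU1P[<-|/complementary_slackness ->].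
  by rewrite mulr0 mul0r.
by rewrite mulrC.
Qed.

End ComplementarySlackness.
End MinCostFlow.

(** * Arcs of the symmetric grid graph *)

Lemma rev_pairK (T : Type) : involutive (@rev_pair T).
Proof. by case. Qed.

(** An arc of [E] lowers one coordinate and raises none, so going there and back cannot restore that
    coordinate. *)
Lemma E_asym (s N : nat) (e : vertex s N * vertex s N) :
  e \in E s N -> rev_pair e \notin E s N.
Proof.
rewrite !inE /= => /andP[_ /existsP[l /eqP e21]].
apply/negP => /andP[_ /existsP[k /eqP]]; rewrite e21 => /rowP/(_ l).
by rewrite !mxE !eqxx /=; case: (l == k) => /=; lra.
Qed.

Lemma rev_pair_Ebar (s N : nat) (e : vertex s N * vertex s N) :
  (rev_pair e \in Ebar s N) = (e \in Ebar s N).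
Proof.
have rev_E p : (p \in [set rev_pair q | q in E s N]) = (rev_pair p \in E s N).
  by rewrite -{1}[p]rev_pairK mem_imset //; apply: can_inj (@rev_pairK _).
by rewrite !in_setU !rev_E rev_pairK orbC.
Qed.

(** By [E_asym], [Ebar] is the disjoint union of [E] and its reversal. *)
Lemma sum_dedge (R : realType) (s N : nat) (P : pred (vertex s N * vertex s N))
    (F : dedge s N -> R) :
  \sum_(a : dedge s N | P (val a)) F a =
  \sum_(e : edge s N | P (val e)) F (fwd e)
  + \sum_(e : edge s N | P (rev_pair (val e))) F (bwd e).
Proof.
rewrite (bigID (fun a : dedge s N => val a \in E s N)) /=; congr (_ + _).
  rewrite (reindex_omap (@fwd s N) (fun a : dedge s N => insub (val a))).
    by apply: eq_bigl => e; rewrite /= valK eqxx (valP e) !andbT.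
  move=> a /andP[_ aE]; rewrite insubT /=; congr Some; exact: val_inj.
rewrite (reindex_omap (@bwd s N) (fun a : dedge s N => insub (rev_pair (val a)))).
  apply: eq_bigl => e.
  by rewrite /= rev_pairK valK eqxx (E_asym _ _ _ (valP e)) !andbT.
move=> a /andP[_ aNE].
have aE : rev_pair (val a) \in E s N.
  have := valP a; rewrite inE (negPf aNE) /= => /imsetP[e eE ->].
  by rewrite rev_pairK.
by rewrite insubT /=; congr Some; apply: val_inj; rewrite /= rev_pairK.
Qed.

(** Reversal swaps source and target, so flow on [bwd e] counts as negative flow on [e]. *)
Lemma bflow_dstar (R : realType) (s N : nat) (f : {ffun dedge s N -> R}) v :
  bflow (dstar f) v =
  \sum_(e : dedge s N | (val e).1 == v) f e
  - \sum_(e : dedge s N | (val e).2 == v) f e.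
Proof.
have sum_dstar (P : pred (edge s N)) : \sum_(e | P e) dstar f e =
    \sum_(e | P e) f (fwd e) - \sum_(e | P e) f (bwd e).
  by rewrite -sumrB; apply: eq_bigr => e _; rewrite ffunE.
rewrite ffunE !sum_dstar (sum_dedge _ _ _ (fun p => p.1 == v)).
by rewrite (sum_dedge _ _ _ (fun p => p.2 == v)) /=; ring.
Qed.

Theorem theorem6 (R : realType) (s N : nat) (d : {ffun edge s N -> R})
    (fstar : {ffun dedge s N -> R}) (xstar : {ffun vertex s N -> R})
    (hf : optimal (Flow d) fstar) (hx : optimal (DualFlow d) xstar) :
  (forall v : vertex s N, bflow d v = bflow (dstar fstar) v)
  /\ Flow d = Flow (dstar fstar)
  /\ DualFlow d = DualFlow (dstar fstar)
  /\ \sum_(e : dedge s N) fstar e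
     = \sum_(v : vertex s N) bflow (dstar fstar) v * xstar v
  /\ \sum_(v : vertex s N) bflow (dstar fstar) v * xstar v
     = norm1 (dstar fstar).
Proof.
case: hf => -[/= f_bal f_ge0] f_opt; case: hx => /= x_feas x_opt.
have bflowE v : bflow d v = bflow (dstar fstar) v by rewrite bflow_dstar f_bal.
(* As an equality of finite functions, this can be rewritten under the binders of [Flow] and
   [DualFlow]. *)
have bflow_eq : bflow d = bflow (dstar fstar) by apply/ffunP.
pose src (e : dedge s N) := (val e).1; pose tgt (e : dedge s N) := (val e).2.
pose w (e : dedge s N) : R := 1.
have sum_w (g : dedge s N -> R) : \sum_e w e * g e = \sum_e g e.
  by apply: eq_bigr => e _; rewrite mul1r.
have div_f v : divergence _ _ _ src tgt fstar v = bflow d v by exact: f_bal.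
(* [DualFlow] bounds target minus source; symmetry of [Ebar] turns this into source minus target. *)
have src_tgt_le e : xstar (src e) - xstar (tgt e) <= w e.
  by apply: x_feas; have := valP e; rewrite -rev_pair_Ebar.
have f_optimal (g : dedge s N -> R) : (forall e, 0 <= g e) ->
    (forall v, divergence _ _ _ src tgt g v = divergence _ _ _ src tgt fstar v) ->
    \sum_e w e * fstar e <= \sum_e w e * g e.
  move=> g_ge0 div_g; rewrite !sum_w.
  have -> : \sum_e g e = \sum_e (finfun g) e by apply: eq_bigr => e _; rewrite ffunE.
  apply: f_opt; split=> [v|e]; last by rewrite ffunE.
  rewrite -div_f -div_g /divergence.
  by congr (_ - _); apply: eq_bigr => e _; rewrite ffunE.
have x_optimal (y : vertex s N -> R) :
    (forall e, y (src e) - y (tgt e) <= w e) ->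
    \sum_v divergence _ _ _ src tgt fstar v * y v
    <= \sum_v divergence _ _ _ src tgt fstar v * xstar v.
  move=> y_feas; under eq_bigr do rewrite div_f.
  under [leRHS]eq_bigr do rewrite div_f.
  have -> : \sum_v bflow d v * y v = \sum_v bflow d v * (finfun y) v.
    by apply: eq_bigr => v _; congr (_ * _); rewrite ffunE.
  apply: x_opt => u v; rewrite -rev_pair_Ebar => vu; rewrite !ffunE.
  exact: (y_feas (Sub (v, u) vu)).
have slack e : 0 < fstar e -> xstar (src e) - xstar (tgt e) = 1.
  exact: (complementary_slackness _ _ _ _ _ w fstar xstar).
have duality : \sum_e fstar e = \sum_v bflow (dstar fstar) v * xstar v.
  rewrite -sum_w (strong_duality _ _ _ src tgt w fstar xstar) //.
  by apply: eq_bigr => v _; rewrite div_f bflow_eq.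
split=> //; split; first by rewrite /Flow bflow_eq.
split; first by rewrite /DualFlow bflow_eq.
split=> //; rewrite -duality (sum_dedge _ _ _ xpredT) -big_split /norm1 /=.
apply: eq_bigr => e _; rewrite ffunE.
have := f_ge0 (fwd e); rewrite le_eqVlt => /predU1P[<-|fwd_gt0].
  by rewrite sub0r normrN ger0_norm ?add0r.
have := f_ge0 (bwd e); rewrite le_eqVlt => /predU1P[<-|bwd_gt0].
  by rewrite subr0 addr0 gtr0_norm.
(* Flow on both arcs would make a difference of [xstar] and its opposite both equal to [1]. *)
by have := slack _ fwd_gt0; have := slack _ bwd_gt0; rewrite /src /tgt /=; lra.
Qed.
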